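(* Let $a_0,\ldots,a_k,b_0,\ldots,b_h\in\mathbb{N}_0$. The following are equivalent: (1) $\langle a_0,a_1,\ldots,a_k\rangle\approx\langle b_0,b_1,\ldots,b_h\rangle$; (2) for every idempotent ultrafilter $\mathcal{U}$: $a_0\,\mathcal{U}\oplus\ldots\oplus a_k\,\mathcal{U}=b_0\,\mathcal{U}\oplus\ldots\oplus b_h\,\mathcal{U}$; (3) for every $\xi\in{}^*\mathbb{N}_0$ such that $\mathfrak{U}_\xi$ is idempotent: $a_0\xi+a_1{}^*\xi+\ldots+a_k{}^{k*}\xi\sim_u b_0\xi+b_1{}^*\xi+\ldots+b_h{}^{h*}\xi$.
   Context: $\mathbb{N}_0$ is the set of non-negative integers. The $u$-equivalence $\approx$ on finite strings of integers is the smallest equivalence relation such that: the empty string is equivalent to $\langle 0\rangle$; $\langle a\rangle\approx\langle a,a\rangle$ for every integer $a$; and if $\sigma\approx\sigma'$, $\tau\approx\tau'$ then $\sigma^\frown\tau\approx\sigma'^\frown\tau'$ (concatenation). Ultrafilters are on $\mathbb{N}_0$; pseudo-sum: $A\in\mathcal{U}\oplus\mathcal{V}$ iff $\{n:A-n\in\mathcal{V}\}\in\mathcal{U}$ with $A-n=\{m:m+n\in A\}$ (associative); $A\in h\,\mathcal{U}$ iff $\{n:nh\in A\}\in\mathcal{U}$. Idempotent: non-principal and $\mathcal{U}\oplus\mathcal{U}=\mathcal{U}$. We work with a nonstandard embedding $*$ defined on all sets, satisfying transfer (so hyper-extensions can be iterated, ${}^{k*}$ denoting the $k$-fold iterate)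 and the $\mathfrak{c}^+$-enlargement property: $\bigcap_{F\in\mathcal{F}}{}^*F\neq\emptyset$ for every family $\mathcal{F}$ of at most continuum many sets with the finite intersection property. For $\nu\in{}^{k*}\mathbb{N}_0$, $\mathfrak{U}_\nu=\{A\subseteq\mathbb{N}_0:\nu\in{}^{k*}A\}$, and $\nu\sim_u\mu$ means $\mathfrak{U}_\nu=\mathfrak{U}_\mu$. *)

(* Defs.v *)
From mathcomp Require Import all_boot all_order all_algebra.
From mathcomp Require Import all_classical.

Set Implicit Arguments.
Unset Strict Implicit.
Unset Printing Implicit Defensive.

Local Open Scope classical_set_scope.

Inductive u_equiv : seq int -> seq int -> Prop :=
| u_equiv_refl s : u_equiv s s
| u_equiv_sym s t : u_equiv s t -> u_equiv t s
| u_equiv_trans s t r : u_equiv s t -> u_equiv t r -> u_equiv s r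
| u_equiv_nil : u_equiv [::] [:: 0%R]
| u_equiv_dup a : u_equiv [:: a] [:: a; a]
| u_equiv_cat s s' t t' :
    u_equiv s s' -> u_equiv t t' -> u_equiv (s ++ t) (s' ++ t').

Definition pseudo_sum (U V : set_system nat) : set_system nat :=
  [set A | U [set n | V [set m | A (m + n)%N]]].

Definition scale (h : nat) (U : set_system nat) : set_system nat :=
  [set A | U [set n | A (n * h)%N]].

Definition idempotent_ultrafilter (U : set_system nat) : Prop :=
  [/\ UltraFilter U, forall n : nat, U <> principal_filter n &
      pseudo_sum U U = U].

(* a_0 U (+) ... (+) a_k U *)
Fixpoint pseudo_lin (U : set_system nat) (a : nat -> nat) (k : nat) :
    set_system nat :=
  if k is j.+1 then pseudo_sum (pseudo_lin U a j) (scale (a k) U)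
  else scale (a 0%N) U.

Section SetSystems.
Variables (T : pointedType) (is_set : set T) (elt : T -> T -> Prop).

Definition ext (A : T) : set T := [set x | elt x A].

(* [small P]: the class P is (the extension of) a set. *)
Definition small (P : set T) : Prop := exists2 A, is_set A & ext A = P.

(* The set with extension P; meaningful only when P is small. *)
Definition collect (P : set T) : T := get [set A | is_set A /\ ext A = P].

End SetSystems.

(* A universe of sets, in which atoms (elements that are not sets) are allowed
   and foundation is not assumed: for well-founded sets without atoms, transfer
   would force *omega = omega.  Separation is for arbitrary subclasses, so that
   [usets_power] gives full power sets. *)
Record universe := Universe {
  ucarrier :> pointedType;
  is_set : set ucarrier;
  elt : ucarrier -> ucarrier -> Prop;
  num : nat -> ucarrier;
  elt_is_set : forall x A, elt x A -> is_set A;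
  usets_ext : forall A B,
    is_set A -> is_set B -> ext elt A = ext elt B -> A = B;
  usets_pair : forall x y, small is_set elt [set x; y];
  usets_union : forall A,
    small is_set elt (\bigcup_(B in ext elt A) ext elt B);
  usets_power : forall A,
    small is_set elt [set B | is_set B /\ ext elt B `<=` ext elt A];
  usets_sep : forall A P, P `<=` ext elt A -> small is_set elt P;
  num_inj : injective num;
  usets_nat : small is_set elt (range num)
}.

(* Bounded formulas of the language of set theory, with natural numbers as
   variables. *)
Inductive bformula :=
| FElt of nat & nat
| FEq of nat & nat
| FIsSet of nat
| FNot of bformula
| FAnd of bformula & bformula
| FOr of bformula & bformula
| FImp of bformula & bformula
| FAll of nat & nat & bformula   (* FAll x y f is (forall x in y, f) *)
| FEx of nat & nat & bformula.

Section Universe.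
Variable V : universe.
Implicit Types (x y A : V) (e : nat -> V) (f : V).

Definition update e (i : nat) (v : V) : nat -> V :=
  fun j => if j == i then v else e j.

Fixpoint satisfies e (phi : bformula) : Prop :=
  match phi with
  | FElt i j => elt (e i) (e j)
  | FEq i j => e i = e j
  | FIsSet i => is_set (e i)
  | FNot p => ~ satisfies e p
  | FAnd p q => satisfies e p /\ satisfies e q
  | FOr p q => satisfies e p \/ satisfies e q
  | FImp p q => satisfies e p -> satisfies e q
  | FAll i j p => forall v, elt v (e j) -> satisfies (update e i v) p
  | FEx i j p => exists2 v, elt v (e j) & satisfies (update e i v) p
  end.

Definition uset (P : set V) : V := collect (@is_set V) (@elt V) P.

Definition opair x y : V := uset [set uset [set x]; uset [set x; y]].

(* The value at x of a function f, given by its graph. *)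
Definition uapp f x : V := get [set y | elt (opair x y) f].

Definition unat_set (A : set nat) : V := uset [set num V n | n in A].

Definition unat_op (op : nat -> nat -> nat) : V :=
  uset [set p | exists m n,
    p = opair (opair (num V m) (num V n)) (num V (op m n))].

End Universe.

Record nonstandard_embedding (V : universe) := NonstandardEmbedding {
  star :> V -> V;
  star_num : forall n, star (num V n) = num V n;
  transfer : forall (phi : bformula) (e : nat -> V),
    satisfies e phi <-> satisfies (star \o e) phi;
  enlargement : forall F : set V,
    (F #<= [set: set nat])%card ->
    finI F (ext (@elt V)) ->
    (\bigcap_(A in F) ext (@elt V) (star A)) !=set0
}.

Section HyperExtensions.
Variables (V : universe) (star : nonstandard_embedding V).

(* The k-fold hyper-extension of A; also the k-fold star of an element. *)
Definition hyper (k : nat) (A : V) : V := iter k star A.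

Definition hnat (k : nat) : V := hyper k (unat_set V setT).

(* Sum and product on hnat k. *)
Definition hadd (k : nat) (x y : V) : V :=
  uapp (hyper k (unat_op V addn)) (opair x y).
Definition hmul (k : nat) (x y : V) : V :=
  uapp (hyper k (unat_op V muln)) (opair x y).

(* The ultrafilter generated by nu, for nu in hnat k. *)
Definition ultra_of (k : nat) (nu : V) : set_system nat :=
  [set A | elt nu (hyper k (unat_set V A))].

Definition u_sim (k : nat) (nu : V) (h : nat) (mu : V) : Prop :=
  ultra_of k nu = ultra_of h mu.

(* a_0 xi + a_1 *xi + ... + a_k k*xi, for xi in hnat 1, as an element of
   hnat k.+1.  Since hyper-extensions increase and star fixes the numerals, the
   partial sum up to j lies in hnat j.+1, hence in hnat j.+2. *)
Fixpoint hyper_lin (xi : V) (a : nat -> nat) (k : nat) : V :=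
  if k is j.+1 then
    hadd k.+1 (hyper_lin xi a j) (hmul k.+1 (num V (a k)) (hyper k xi))
  else hmul 1 (num V (a 0%N)) xi.

End HyperExtensions.

(* Main.v *)
(** (1) => (2): a string acts on ultrafilters through a morphism of monoids from
    strings to ultrafilters with (+), and the defining relations of u-equivalence
    hold since a U (+) a U = a (U (+) U) = a U and 0 U is principal at 0.

    (2) => (1): take B larger than all the coefficients and an idempotent U
    concentrating, for every N, on the positive multiples of B^N whose base-B
    digits are 0 and 1.  Almost all elements for a_0 U (+) ... (+) a_k U have a
    base-B digit string made of runs of a_0, then of a_1, and so on, separated by
    zeros; it is u-equivalent to <a_0, ..., a_k>.  If both sums agree, some
    number is generic for both, and its digits link the two strings.

    (2) <=> (3): by transfer the left-hand side of (3) generates the ultrafilter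
    a_0 V (+) ... (+) a_k V with V generated by xi, and by enlargement every
    ultrafilter is generated by some xi. *)

Require Import Defs.
From mathcomp Require Import all_boot all_order all_algebra.
From mathcomp Require Import all_classical.
From mathcomp Require Import finmap.

Set Implicit Arguments.
Unset Strict Implicit.
Unset Printing Implicit Defensive.

Local Open Scope classical_set_scope.

(** * Idempotent ultrafilters *)

(** Encodes a closed subsemigroup: by the inclusion, [pseudo_sum U W] extends [F] whenever the
    ultrafilters [U] and [W] do. *)
Definition additive_filter (F : set_system nat) : Prop :=
  ProperFilter F /\ F `<=` pseudo_sum F F.

Lemma additive_filter_max (F0 : set_system nat) : additive_filter F0 ->
  exists F, [/\ additive_filter F, F0 `<=` F &
    forall G, additive_filter G -> F `<=` G -> G = F].
Proof.
move=> aF0; pose P G := G = set0 \/ (additive_filter G /\ F0 `<=` G).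
have [|F [PF Fmax]] := @Zorn_bigcup (set nat) P.
  move=> C CP Ctot; have [C0|] := pselect (forall X, C X -> X = set0).
    left; rewrite -subset0 => A [X CX XA]; by rewrite (C0 X CX) in XA.
  move=> /existsNP [X0 /not_implyP [CX0 X0N0]]; right.
  have goodX X A : C X -> X A -> additive_filter X /\ F0 `<=` X.
    by move=> /CP[-> //|].
  have [aX0 F0X0] : additive_filter X0 /\ F0 `<=` X0 by case: (CP _ CX0).
  split; last by move=> A /F0X0 X0A; exists X0.
  split; first split.
  - move=> [X CX XE]; have [[pX _] _] := goodX _ _ CX XE.
    exact: (@filter_not_empty _ X).
  - split.
    + by exists X0 => //; case: aX0 => pX0 _; exact: filterT.
    + move=> A B [X CX XA] [Y CY YB].
      have [[pX _] _] := goodX _ _ CX XA; have [[pY _] _] := goodX _ _ CY YB.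
      have [XY|YX] := Ctot _ _ CX CY.
        by exists Y => //; apply: filterI => //; exact: XY.
      by exists X => //; apply: filterI => //; exact: YX.
    + move=> A B AB [X CX XA]; have [[pX _] _] := goodX _ _ CX XA.
      by exists X => //; exact: (filterS AB).
  - move=> A [X CX XA]; have [[pX aX] _] := goodX _ _ CX XA.
    exists X => //; move: (aX _ XA); rewrite /pseudo_sum /=; apply: filterS => n XAn.
    by exists X.
have {PF}[aF F0F] : additive_filter F /\ F0 `<=` F.
  case: PF => // F_0; exfalso; apply: (Fmax F0); last by right; split.
  rewrite F_0; split => // /(_ setT) /=; apply; case: aF0 => pF0 _; exact: filterT.
exists F; split => // G aG FG; apply: contrapT => GF; apply: (Fmax G).
  by split => // GF'; apply: GF; apply/seteqP; split.
by right; split => //; exact: subset_trans FG.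
Qed.

Lemma pseudo_sumE (U V : set_system nat) A :
  pseudo_sum U V A = U [set n | V [set m | A (m + n)%N]].
Proof. by []. Qed.

Lemma pseudo_sum_filter (F G : set_system nat) :
  ProperFilter F -> ProperFilter G -> ProperFilter (pseudo_sum F G).
Proof.
move=> pF pG; split.
- rewrite pseudo_sumE => H; apply: (@filter_not_empty _ F).
  by apply: filterS H => n /= H; exact: (@filter_not_empty _ G).
- split.
  + by rewrite pseudo_sumE; apply: filterS filterT => n _; exact: filterT.
  + rewrite /pseudo_sum /mkset => A B FA FB.
    apply: filterS (filterI FA FB) => n [/= GA GB].
    exact: filterI.
  + rewrite /pseudo_sum /mkset => A B AB; apply: filterS => n.
    by apply: filterS => m; exact: AB.
Qed.

Lemma ultra_setC (U : set_system nat) : UltraFilter U ->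
  forall A, U (~` A) <-> ~ U A.
Proof.
move=> uU A; split => [UnA UA|nUA].
  by apply: (@filter_not_empty _ U); rewrite -(setICr A); exact: filterI.
by have [|//] := in_ultra_setVsetC A uU.
Qed.

Lemma eq_ultra (U F : set_system nat) :
  UltraFilter U -> ProperFilter F -> U `<=` F -> F = U.
Proof. by move=> uU pF UF; apply: max_filter. Qed.

(* Ellis' argument, a filter F standing for the closed set of the ultrafilters
   extending it: for any U extending F, maximality gives F (+) U = F, and then
   G, which stands for {W extending F | W (+) U = U}, is also F. *)
Lemma max_additive_filter_ultra (F : set_system nat) : additive_filter F ->
  (forall G, additive_filter G -> F `<=` G -> G = F) ->
  UltraFilter F /\ pseudo_sum F F = F.
Proof.
move=> [pF aF] Fmax.
have [U [uU FU]] := ultraFilterLemma pF.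
have FUF : pseudo_sum F U = F.
  have FsubFU : F `<=` pseudo_sum F U.
    by move=> A /aF; rewrite !pseudo_sumE; apply: filterS => n; exact: FU.
  apply: Fmax => //; split; first exact: pseudo_sum_filter.
  move=> A; rewrite pseudo_sumE => /aF; rewrite pseudo_sumE => /FsubFU FUA.
  have pFU := pseudo_sum_filter pF (@ultra_proper _ _ uU).
  rewrite pseudo_sumE; apply: filterS FUA => n /=.
  rewrite pseudo_sumE; apply: filterS => i /=; apply: filterS => m.
  by rewrite /mkset addnA.
pose shift A := [set n | U [set m | A (m + n)%N]].
pose G := [set A | exists X B, [/\ F X, U B & X `&` shift B `<=` A]].
have GF : G = F.
  apply: Fmax; last first.
    by move=> A FA; exists A, setT; split => //; exact: filterT.
  split; first split.
  - move=> [X [B [FX UB XB]]].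
    (* If [X] misses [shift B], the complement of [B] lies in [pseudo_sum F U], which is [F], hence
       in [U], against [U B]. *)
    suff : F (~` B) by move=> /FU /ultra_setC.
    rewrite -FUF; apply: filterS FX => n Xn /=.
    by apply/(@ultra_setC _ uU [set m | B (m + n)%N]) => Bn; exact: (XB n).
  - split.
    + by exists setT, setT; split; [exact: filterT|exact: filterT|].
    + move=> A1 A2 [X1 [B1 [FX1 UB1 XB1]]] [X2 [B2 [FX2 UB2 XB2]]].
      exists (X1 `&` X2), (B1 `&` B2); split; [exact: filterI|exact: filterI|].
      move=> n [[X1n X2n] Bn]; split.
        by apply: XB1; split => //; apply: filterS Bn => m [].
      by apply: XB2; split => //; apply: filterS Bn => m [].
    + move=> A1 A2 AA [X [B [FX UB XB]]]; exists X, B; split => //.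
      exact: subset_trans AA.
  - move=> A [X [B [FX UB XB]]].
    (* At each [k] of this new intersection, [X - k] is in [F] and [B - k] is in [U]; the shifted
       pair witnesses that [A - k] is in [G]. *)
    exists [set n | F [set m | X (m + n)%N]], B; split => //; first exact: aF.
    move=> k [/= Xk Bk].
    exists [set m | X (m + k)%N], [set m | B (m + k)%N]; split => //.
    move=> n [/= Xn Bn]; apply: XB; split => //.
    by apply: filterS Bn => m /=; rewrite addnA.
have UF : U `<=` F.
  move=> A UA; rewrite -FUF /pseudo_sum /= -GF.
  by exists setT, A; split => //; exact: filterT.
have -> : F = U by apply: eq_ultra.
split => //; apply: eq_ultra => //; first exact: pseudo_sum_filter.
have <- : F = U by apply: eq_ultra.
exact: aF.
Qed.

(** The principal filter at 0 also satisfies the fixed-point equation, so non-principality is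
    inherited from [F0]. *)
Lemma idempotent_above (F0 : set_system nat) : additive_filter F0 ->
  (forall n, ~ (F0 `<=` principal_filter n)) ->
  exists2 U, idempotent_ultrafilter U & F0 `<=` U.
Proof.
move=> /additive_filter_max[F [aF F0F Fmax]] np.
have [uF idF] := max_additive_filter_ultra aF Fmax.
by exists F => //; split => // n FE; apply: (np n); rewrite -FE.
Qed.

(** * Strings in the monoid of ultrafilters *)

Lemma pseudo_sumA (U V W : set_system nat) :
  pseudo_sum U (pseudo_sum V W) = pseudo_sum (pseudo_sum U V) W.
Proof.
apply/funext => A; rewrite /pseudo_sum /mkset.
by do 2![congr (_ _); apply/funext => ?]; congr (W _); apply/funext => ?; rewrite addnA.
Qed.

Lemma pseudo_sum0 (U : set_system nat) : pseudo_sum U (principal_filter 0) = U.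
Proof.
apply/funext => A; rewrite /pseudo_sum /mkset; congr (U _); apply/funext => n.
by apply/propext; split => [/principal_filterP|An]; last by apply/principal_filterP.
Qed.

Lemma pseudo_0sum (U : set_system nat) : pseudo_sum (principal_filter 0) U = U.
Proof.
apply/funext => A; rewrite pseudo_sumE; apply/propext.
have E : [set m | A (m + 0)%N] = A.
  by apply/funext => m; rewrite /mkset addn0.
by rewrite principal_filterP /= E.
Qed.

Lemma scaleE h (U : set_system nat) A : scale h U A = U [set n | A (n * h)%N].
Proof. by []. Qed.

Lemma scale0 (U : set_system nat) : ProperFilter U ->
  scale 0 U = principal_filter 0.
Proof.
move=> pU; apply/funext => A; rewrite /scale /mkset; apply/propext.
split => [UA|/principal_filterP A0].
  apply/principal_filterP; apply: contrapT => A0.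
  apply: (@filter_not_empty _ U); apply: filterS UA => n /=.
  by rewrite /mkset muln0.
by apply: filterS filterT => n _ /=; rewrite /mkset muln0.
Qed.

Lemma scale_pseudo_sum h (U V : set_system nat) :
  scale h (pseudo_sum U V) = pseudo_sum (scale h U) (scale h V).
Proof.
apply/funext => A; rewrite /scale /pseudo_sum /mkset.
congr (U _); apply/funext => n; congr (V _); apply/funext => m.
by rewrite mulnDl.
Qed.

(** A derivation of [u_equiv] may pass through negative letters; [absz] gives them a meaning
    compatible with the generating relations. *)
Definition string_sum (U : set_system nat) (s : seq int) : set_system nat :=
  foldr (fun a F => pseudo_sum (scale (absz a) U) F) (principal_filter 0) s.

Lemma scale_filter h (U : set_system nat) : ProperFilter U -> ProperFilter (scale h U).
Proof.
move=> pU; split.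
  rewrite scaleE => H; apply: (@filter_not_empty _ U).
  by apply: filterS H.
split.
- by rewrite scaleE; exact: filterT.
- by move=> P Q; rewrite !scaleE; exact: filterI.
- by move=> P Q PQ; rewrite !scaleE; apply: filterS => n; exact: PQ.
Qed.

Lemma string_sum_filter (U : set_system nat) s :
  ProperFilter U -> ProperFilter (string_sum U s).
Proof.
move=> pU; elim: s => [|a s IH] /=; first exact: principal_filter_proper.
by apply: pseudo_sum_filter => //; exact: scale_filter.
Qed.

Lemma string_sum_cat U s t :
  string_sum U (s ++ t) = pseudo_sum (string_sum U s) (string_sum U t).
Proof.
elim: s => [|a s IH] /=; first by rewrite pseudo_0sum.
by rewrite IH pseudo_sumA.
Qed.

Lemma string_sum_u_equiv U s t : idempotent_ultrafilter U ->
  u_equiv s t -> string_sum U s = string_sum U t.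
Proof.
move=> [uU _ idU]; elim => //=.
- by move=> ? ? ? _ -> _ ->.
- by rewrite pseudo_sum0 scale0.
- by move=> a; rewrite !pseudo_sum0 -scale_pseudo_sum idU.
- by move=> s1 s2 t1 t2 _ E _ E'; rewrite !string_sum_cat E E'.
Qed.

Lemma string_sum_iota U (a : nat -> nat) k :
  string_sum U [seq Posz (a i) | i <- iota 0 k.+1] = pseudo_lin U a k.
Proof.
elim: k => [|k IH]; first by rewrite /= pseudo_sum0.
by rewrite -[in LHS]addn1 iotaD map_cat string_sum_cat IH /= pseudo_sum0.
Qed.

(** * Digit strings *)

(** Least significant digit first, at fixed length [N]: adding a multiple of [B ^ N] to a number
    below [B ^ N] leaves these digits unchanged and appends on the right. *)
Definition digits (B N n : nat) : seq int :=
  [seq Posz ((n %/ B ^ i) %% B) | i <- iota 0 N].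

Lemma digits_cat B N M m q : (0 < B)%N -> (m < B ^ N)%N ->
  digits B (N + M) (m + B ^ N * q) = digits B N m ++ digits B M q.
Proof.
move=> B0 mN; rewrite /digits iotaD map_cat; congr (_ ++ _).
  apply/eq_in_map => i; rewrite mem_iota /= add0n => iN; congr Posz.
  have -> : (B ^ N * q = (B ^ (N - i.+1) * q * B) * B ^ i)%N.
    by rewrite -{1}(subnK iN) expnD expnS mulnAC mulnA.
  by rewrite divnDMl ?expn_gt0 ?B0 // addnC modnMDl.
rewrite add0n -[X in iota X _](addn0 N) iotaDl -map_comp.
apply/eq_map => i /=; congr (Posz (_ %% _)).
by rewrite expnD divnMA addnC mulnC divnMDl ?expn_gt0 ?B0 // (divn_small mN) addn0.
Qed.

Lemma u_equiv_catl s t : u_equiv s [::] -> u_equiv (s ++ t) t.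
Proof. by move=> e; exact: (u_equiv_cat e (u_equiv_refl t)). Qed.

Lemma u_equiv_catr s t : u_equiv t [::] -> u_equiv (s ++ t) s.
Proof.
by move=> e; rewrite -[X in u_equiv _ X]cats0; exact: (u_equiv_cat (u_equiv_refl s) e).
Qed.

Lemma u_equiv_00 : u_equiv [:: Posz 0] [::].
Proof. exact/u_equiv_sym/u_equiv_nil. Qed.

(** Padding only appends zeros, each u-equivalent to the empty string, so digit strings of different
    lengths can be compared. *)
Lemma digits_zeros B N K q : (0 < B)%N -> (q < B ^ N)%N ->
  u_equiv (digits B (N + K) q) (digits B N q).
Proof.
move=> B0 qN; rewrite -[q in digits B (N + K) q]addn0 -(muln0 (B ^ N)) digits_cat //.
apply: u_equiv_catr; elim: K => [|K IH]; first exact: u_equiv_refl.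
have := @digits_cat B 1 K 0 0 B0; rewrite muln0 add1n expn1 => -> //.
apply: (u_equiv_trans _ IH); apply: u_equiv_catl.
by rewrite /digits /= div0n mod0n; exact: u_equiv_00.
Qed.

(* The numbers whose base-B digits are all 0 or 1. *)
Inductive sparse (B : nat) : nat -> Prop :=
| sparse_0 : sparse B 0
| sparse_shift n : sparse B n -> sparse B (B * n)
| sparse_succ n : sparse B n -> sparse B (1 + B * n).

Lemma sparse_expn B N n : sparse B n -> sparse B (B ^ N * n).
Proof.
by move=> sn; elim: N => [|N]; rewrite ?mul1n// expnS -mulnA; exact: sparse_shift.
Qed.

(** [K] counts the digits in the derivation of [sparse B s]; the digits of [t] are written after
    them, without carry. *)
Lemma sparse_add B s : sparse B s ->
  exists K, forall t, sparse B t -> sparse B (s + B ^ K * t).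
Proof.
elim => [|n _ [K IH]|n _ [K IH]].
- by exists 0%N => t; rewrite add0n mul1n.
- exists K.+1 => t /IH st; rewrite expnS -mulnA -mulnDr; exact: sparse_shift.
- by exists K.+1 => t /IH st; rewrite expnS -mulnA -addnA -mulnDr; exact: sparse_succ.
Qed.

(** As [c < B], multiplying by [c] creates no carry: each digit 1 becomes [c], zeros are erased and
    repeated letters [c] merge. *)
Lemma digits_sparse B c s : (c < B)%N -> sparse B s ->
  exists2 N, (s * c < B ^ N)%N &
    u_equiv (digits B N (s * c)) [:: Posz (if s == 0 then 0 else c)].
Proof.
move=> cB; have B0 : (0 < B)%N by exact: leq_ltn_trans cB.
have dup x : u_equiv [:: x; x] [:: x] by exact/u_equiv_sym/u_equiv_dup.
have bound d N q : (d < B)%N -> (q < B ^ N)%N -> (d + B ^ 1 * q < B ^ N.+1)%N.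
  move=> dB qN; rewrite expn1 expnS; apply: (@leq_trans (B + B * q)).
    by rewrite ltn_add2r.
  by rewrite -mulnS leq_mul2l qN orbT.
have dig d N q : (d < B)%N -> digits B N.+1 (d + B ^ 1 * q) = Posz d :: digits B N q.
  move=> dB; rewrite -add1n digits_cat ?expn1 //=; congr (Posz _ :: _).
  by rewrite /= divn1 modn_small.
elim => [|n _ [N nN IH]|n _ [N nN IH]].
- by exists 0%N => //; rewrite mul0n; exact: u_equiv_nil.
- exists N.+1; rewrite -mulnA -[(B * _)%N]add0n -{2}(expn1 B); first exact: bound.
  rewrite dig // muln_eq0 (gtn_eqF B0) /=.
  apply: (u_equiv_trans _ IH); exact: (u_equiv_catl _ u_equiv_00).
- have -> : ((1 + B * n) * c = c + B ^ 1 * (n * c))%N by rewrite mulnDl mul1n expn1 mulnA.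
  exists N.+1; first exact: bound.
  rewrite dig //=; apply: (u_equiv_trans (u_equiv_cat (u_equiv_refl [:: Posz c]) IH)).
  by case: ifP => _; [exact: (@u_equiv_catr [:: Posz c] _ u_equiv_00)|exact: dup].
Qed.

(** Positivity of [s] keeps the elements at least [B ^ N], which rules out principal ultrafilters,
    and makes [c] rather than 0 the letter read by [digits_sparse]. *)
Definition sparse_tail (B N : nat) : set nat :=
  [set n | exists s, [/\ sparse B s, (0 < s)%N & n = B ^ N * s]%N].

Lemma sparse_tail_le B N M : (0 < B)%N -> (N <= M)%N ->
  sparse_tail B M `<=` sparse_tail B N.
Proof.
move=> B0 NM _ [s [ss s0 ->]]; exists (B ^ (M - N) * s)%N; split.
- exact: sparse_expn.
- by rewrite muln_gt0 expn_gt0 B0.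
- by rewrite mulnA -expnD subnKC.
Qed.

Lemma sparse_idempotent B : (1 < B)%N ->
  exists2 U, idempotent_ultrafilter U & forall N, U (sparse_tail B N).
Proof.
move=> B1; have B0 : (0 < B)%N by exact: ltnW.
pose F0 := filter_from setT (sparse_tail B).
have pF0 : ProperFilter F0.
  apply: filter_from_proper; last first.
    move=> N _; exists (B ^ N * 1)%N; exists 1%N; split => //.
    by have := sparse_succ (sparse_0 B); rewrite muln0.
  apply: filter_from_filter; first by exists 0%N.
  move=> N M _ _; exists (maxn N M) => // n Sn.
  by split; apply: sparse_tail_le Sn => //; rewrite ?leq_maxl ?leq_maxr.
have [|n F0n|U iU F0U] := @idempotent_above F0.
- split => // A [N _ SA]; rewrite pseudo_sumE; exists N => //.
  move=> _ [s [/sparse_add[K sK] s0 ->]].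
  (* The digits of [B ^ N * s] end before position [N + K], so any element of this tail can be added
     to it without carry. *)
  exists (N + K)%N => // _ [t [st t0 ->]]; apply: SA.
  exists (s + B ^ K * t)%N; split; first exact: sK.
    by rewrite addn_gt0 s0.
  by rewrite mulnDr addnC mulnA expnD.
(* Otherwise [n] would be a positive multiple of [B ^ n], which exceeds [n]. *)
- have /F0n/principal_filterP[s [_ s0 E]] : F0 (sparse_tail B n) by exists n.
  have : (n < n)%N; last by rewrite ltnn.
  rewrite [X in (_ < X)%N]E; apply: (leq_trans (ltn_expl n B1)).
  by rewrite leq_pmulr.
- by exists U => // N; apply: F0U; exists N.
Qed.

(** The shift [M] makes the induction on strings possible: once the first term is chosen, the rest
    of the sum must start at a later position. *)
Definition digits_equiv (B M : nat) (s : seq int) : set nat :=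
  [set m | exists N q, [/\ m = B ^ M * q, q < B ^ N & u_equiv (digits B N q) s]%N].

(* In a generic element of the sum, each term is a multiple of a power of B
   exceeding the partial sum before it, so that digit strings concatenate. *)
Lemma string_sum_digits B U (s : seq nat) : ProperFilter U ->
  (forall N, U (sparse_tail B N)) -> {in s, forall c, (c < B)%N} ->
  forall M, string_sum U (map Posz s) (digits_equiv B M (map Posz s)).
Proof.
move=> pU US; elim: s => [|c s IH] sB M.
  apply/principal_filterP; exists 0%N, 0%N.
  by split; [rewrite muln0| |exact: u_equiv_refl].
have pS := string_sum_filter (map Posz s) pU.
rewrite [string_sum _ _]/= pseudo_sumE scaleE; apply: (filterS _ (US M)).
move=> _ [t [st t0 ->]] /=.
have cB : (c < B)%N by apply: sB; rewrite mem_head.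
have B0 : (0 < B)%N by exact: leq_ltn_trans cB.
have [N1 tN1] := digits_sparse cB st; rewrite gtn_eqF // => tc.
have {}IH := IH (fun x xs => sB x (@mem_behead _ (c :: s) x xs)).
(* The first term, [B ^ M * t * c], has its digits below position [M + N1], where the rest of the
   sum begins. *)
apply: filterS (IH (M + N1)%N) => _ [N [q [-> qN qs]]].
exists (N1 + N)%N, (t * c + B ^ N1 * q)%N; split.
- by rewrite mulnDr addnC mulnA expnD mulnA.
- rewrite expnD; apply: (@leq_trans (B ^ N1 + B ^ N1 * q)); first by rewrite ltn_add2r.
  by rewrite -mulnS leq_mul2l qN orbT.
- by rewrite digits_cat //; exact: (u_equiv_cat tc qs).
Qed.

Lemma digits_equiv_inj B s t m : (0 < B)%N ->
  digits_equiv B 0 s m -> digits_equiv B 0 t m -> u_equiv s t.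
Proof.
move=> B0 [N [q [-> qN qs]]] [M [r [+ rM rt]]]; rewrite !mul1n => E; subst r.
apply: (u_equiv_trans (u_equiv_sym qs)); apply: (u_equiv_trans _ rt).
apply: (u_equiv_trans (u_equiv_sym (digits_zeros M B0 qN))).
by rewrite addnC; exact: digits_zeros.
Qed.

Lemma u_equiv_string_sum (s t : seq nat) :
  (forall U, idempotent_ultrafilter U ->
     string_sum U (map Posz s) = string_sum U (map Posz t)) ->
  u_equiv (map Posz s) (map Posz t).
Proof.
(* One successor makes [B] exceed every letter; the other gives [1 < B] even when all letters are
   0. *)
pose B := (\max_(c <- s ++ t) c).+2 => H.
have stB c : c \in s ++ t -> (c < B)%N by move=> cst; rewrite ltnS leqW // leq_bigmax_seq.
have [U iU US] := @sparse_idempotent B isT.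
have pU : ProperFilter U by case: iU => uU _ _; exact: ultra_proper.
have digU r : {subset r <= s ++ t} ->
    string_sum U (map Posz r) (digits_equiv B 0 (map Posz r)).
  by move=> rst; apply: string_sum_digits => // c /rst; exact: stB.
have sU : string_sum U (map Posz s) (digits_equiv B 0 (map Posz s)).
  by apply: digU => c cs; rewrite mem_cat cs.
have tU : string_sum U (map Posz t) (digits_equiv B 0 (map Posz t)).
  by apply: digU => c ct; rewrite mem_cat ct orbT.
rewrite -(H U iU) in tU.
have pS := string_sum_filter (map Posz s) pU.
have [m [sm tm]] := filter_ex (filterI sU tU).
exact: (digits_equiv_inj _ sm tm).
Qed.

(** * Transfer *)

Section Sets.
Variable V : universe.
Implicit Types (x y z A B f N : V).

Lemma usetP (P : set V) : small (@is_set V) (@elt V) P ->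
  is_set (uset P) /\ ext (@elt V) (uset P) = P.
Proof.
move=> [A As AP].
exact: (@getPex _ [set A | is_set A /\ ext (@elt V) A = P] (ex_intro _ A (conj As AP))).
Qed.

Lemma usetE (P : set V) : small (@is_set V) (@elt V) P ->
  forall x, elt x (uset P) <-> P x.
Proof. by move=> /usetP[_ E] x; rewrite -[X in _ <-> X x]E. Qed.

Lemma uset_pairE x y z : elt z (uset [set x; y]) <-> z = x \/ z = y.
Proof. exact: (usetE (usets_pair x y)). Qed.

Lemma small1 x : small (@is_set V) (@elt V) [set x].
Proof. by rewrite -(setUid [set x]); exact: usets_pair. Qed.

Lemma eq_uset (P : set V) A : small (@is_set V) (@elt V) P ->
  is_set A -> (forall x, elt x A <-> P x) -> A = uset P.
Proof.
move=> /usetP[sP EP] sA AP; apply: usets_ext => //.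
by rewrite EP; apply/funext => x; apply/propext/AP.
Qed.

Lemma opair_inj x y x' y' : opair x y = opair x' y' -> x = x' /\ y = y'.
Proof.
have e1 u : forall z, elt z (uset [set u]) <-> z = u by exact/usetE/small1.
have e2 := uset_pairE.
move=> E.
have E1 : uset [set x] = uset [set x'].
  have : elt (uset [set x]) (opair x' y') by rewrite -E; apply/e2; left.
  move=> /e2[//|E1].
  by have /e1 <- : elt x' (uset [set x]) by rewrite E1; apply/e2; left.
have xx' : x = x' by apply/e1; rewrite -E1; apply/e1.
subst x'; split => //.
have H : elt (uset [set x; y]) (opair x y') by rewrite -E; apply/e2; right.
have H' : elt (uset [set x; y']) (opair x y) by rewrite E; apply/e2; right.
have : elt y (uset [set x; y]) by apply/e2; right.
have : elt y' (uset [set x; y']) by apply/e2; right.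
move: H' => /e2[] -> y'x; move: H => /e2[] -> yx.
- by move: y'x yx => /e1 -> /e1 ->.
- by move: y'x yx => /e1 -> /e2[] ->.
- by move: y'x yx => /e2[] -> /e1 ->.
- by move: y'x yx => /e2[]-> // /e2[]->.
Qed.

(** Pairs of elements of [A] lie in its double power set; with this bound, separation turns graphs
    into sets. *)
Lemma opair_bound A : exists C, forall x y, elt x A -> elt y A -> elt (opair x y) C.
Proof.
have [D _ DE] := usets_power A; have [C _ CE] := usets_power D.
have inD x y : elt x A -> elt y A -> elt (uset [set x; y]) D.
  move=> xA yA; have [sP EP] := usetP (usets_pair x y).
  suff : ext (@elt V) D (uset [set x; y]) by [].
  rewrite DE; split => // z; rewrite EP => -[]-> //.
exists C => x y xA yA.
have [sP EP] := usetP (usets_pair (uset [set x]) (uset [set x; y])).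
suff : ext (@elt V) C (opair x y) by [].
rewrite CE; split => // z; rewrite EP => -[]->; last exact: inD.
by rewrite -(setUid [set x]); exact: inD.
Qed.

Lemma unat_setE (A : set nat) x : elt x (unat_set V A) <-> exists2 n, A n & x = num V n.
Proof.
have [N _ NE] := usets_nat V.
rewrite usetE; first by split=> -[n An e]; exists n.
apply: (@usets_sep V N) => _ [n _ <-]; suff : ext (@elt V) N (num V n) by [].
by rewrite NE; exists n.
Qed.

Lemma elt_unat_set (A : set nat) n : elt (num V n) (unat_set V A) <-> A n.
Proof.
rewrite unat_setE; split => [[m Am /num_inj -> //]|An]; by exists n.
Qed.

Lemma unat_opE op p : elt p (unat_op V op) <-> exists m n,
    p = opair (opair (num V m) (num V n)) (num V (op m n)).
Proof.
apply: usetE.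
pose N := unat_set V setT.
have [C CP] := opair_bound N.
have [D _ DE] := usets_pair N C.
have [E _ EE] := usets_union D.
have [F FP] := opair_bound E.
apply: (@usets_sep V F) => _ [m [n ->]].
have inN i : elt (num V i) N by apply/elt_unat_set.
have sub X x : X = N \/ X = C -> elt x X -> elt x E.
  move=> XNC xX; suff : ext (@elt V) E x by [].
  by rewrite EE; exists X => //; rewrite DE.
by apply: FP; [apply: (sub C); [right|exact: CP]|apply: (sub N); [left|]].
Qed.

Lemma unat_op_graph op m n z :
  elt (opair (opair (num V m) (num V n)) z) (unat_op V op) <-> z = num V (op m n).
Proof.
rewrite unat_opE; split => [[m' [n' /opair_inj[/opair_inj[]]]]|->].
  by move=> /num_inj -> /num_inj ->.
by exists m, n.
Qed.

End Sets.

(* Variables 40 to 52 are reserved for the bound variables of these macros.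
   [FGraph f x y z] says that ((x, y), z) belongs to f. *)
Definition FPair (z x y : nat) : bformula :=
  FAnd (FIsSet z) (FEx 50 z (FEx 51 z
    (FAnd (FAnd (FIsSet 50) (FAnd (FElt x 50) (FAll 52 50 (FEq 52 x))))
    (FAnd (FAnd (FIsSet 51) (FAnd (FElt x 51)
                (FAnd (FElt y 51) (FAll 52 51 (FOr (FEq 52 x) (FEq 52 y))))))
          (FAll 52 z (FOr (FEq 52 50) (FEq 52 51))))))).

Definition FGraph (f x y z : nat) : bformula :=
  FEx 40 f (FEx 41 40 (FEx 42 41 (FAnd (FPair 42 x y) (FPair 40 42 z)))).

Arguments FPair : simpl never.
Arguments FGraph : simpl never.

(** * Meaning of the bounded formulas for pairs and graphs *)

Section Formulas.
Variable V : universe.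
Implicit Types (e : nat -> V) (f x y z : nat).

Lemma sat_FAnd e p q : satisfies e (FAnd p q) <-> satisfies e p /\ satisfies e q.
Proof. by []. Qed.

Lemma sat_FImp e p q : satisfies e (FImp p q) <-> (satisfies e p -> satisfies e q).
Proof. by []. Qed.

Lemma sat_FAll e i j p : satisfies e (FAll i j p) <->
  forall v, elt v (e j) -> satisfies (update e i v) p.
Proof. by []. Qed.

Lemma sat_FEx e i j p : satisfies e (FEx i j p) <->
  exists2 v, elt v (e j) & satisfies (update e i v) p.
Proof. by []. Qed.

Lemma updateE e i v j : update e i v j = if j == i then v else e j.
Proof. by []. Qed.

(** Variables 50 and 51 play the singleton and the doubleton of the Kuratowski pair; the
    inequalities prevent capture. *)
Lemma sat_FPair e z x y : (z < 50)%N -> (x < 50)%N -> (y < 50)%N ->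
  satisfies e (FPair z x y) <-> e z = opair (e x) (e y).
Proof.
move=> z50 x50 y50.
have ne w i : (w < 50)%N -> (50 <= i)%N -> (w == i) = false.
  by move=> w50 i50; rewrite ltn_eqF // (leq_trans w50).
pose neE := (ne z 50 z50 isT, ne z 51 z50 isT, ne z 52 z50 isT,
  ne x 50 x50 isT, ne x 51 x50 isT, ne x 52 x50 isT,
  ne y 50 y50 isT, ne y 51 y50 isT, ne y 52 y50 isT).
rewrite /FPair /= /update /= !neE.
have u1 : small (@is_set V) (@elt V) [set e x] := small1 (e x).
have u2 := usets_pair (e x) (e y).
split => [[sz [s sinz [t tinz]]] [[ss [xs sx]] [[st [xt [yt txy]]] zst]]|ez].
  have Es : s = uset [set e x].
    by apply: eq_uset => // w; split => [/sx|->].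
  have Et : t = uset [set e x; e y].
    by apply: eq_uset => // w; split => [/txy|[]->].
  rewrite /opair -Es -Et; apply: eq_uset => // [|w]; first exact: usets_pair.
  by split => [/zst|[]->].
have [sz Ez] := usetP (usets_pair (uset [set e x]) (uset [set e x; e y])).
have [s1 _] := usetP u1; have [s2 _] := usetP u2.
have e1 := usetE u1; have e2 := usetE u2.
split; first by rewrite ez.
exists (uset [set e x]); first by rewrite ez; apply/uset_pairE; left.
exists (uset [set e x; e y]); first by rewrite ez; apply/uset_pairE; right.
split; first by split => //; split => [|w /e1]; first exact/e1.
split; last by move=> w; rewrite ez => /uset_pairE.
split => //; split; first by apply/e2; left.
by split => [|w /e2]; first by apply/e2; right.
Qed.

(** The inner pair is reached by bounded quantifiers, as an element of an element of a member of the
    graph: the singleton in a Kuratowski pair contains its first component. *)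
Lemma sat_FGraph e f x y z : (f < 40)%N -> (x < 40)%N -> (y < 40)%N -> (z < 40)%N ->
  satisfies e (FGraph f x y z) <-> elt (opair (opair (e x) (e y)) (e z)) (e f).
Proof.
move=> f40 x40 y40 z40.
have ne w i : (w < 40)%N -> (40 <= i)%N -> (w == i) = false.
  by move=> w40 i40; rewrite ltn_eqF // (leq_trans w40).
pose neE := (ne x 40 x40 isT, ne x 41 x40 isT, ne x 42 x40 isT,
  ne y 40 y40 isT, ne y 41 y40 isT, ne y 42 y40 isT,
  ne z 40 z40 isT, ne z 41 z40 isT, ne z 42 z40 isT, ne f 40 f40 isT).
have [x50 [y50 z50]] : (x < 50)%N /\ (y < 50)%N /\ (z < 50)%N.
  by split; [|split]; apply: (@leq_trans 40).
split.
  move=> /sat_FEx[p pf /sat_FEx[s sp /sat_FEx[q qs /sat_FAnd[]]]].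
  move=> /(sat_FPair _ (isT : 42 < 50)%N x50 y50) Eq.
  move=> /(sat_FPair _ (isT : 40 < 50)%N (isT : 42 < 50)%N z50) Ep.
  by move: Eq Ep pf; rewrite !updateE /= !neE => -> ->.
move=> H; apply/sat_FEx; exists (opair (opair (e x) (e y)) (e z)); first exact: H.
apply/sat_FEx; exists (uset [set opair (e x) (e y)]); first by apply/uset_pairE; left.
apply/sat_FEx; exists (opair (e x) (e y)); first exact/(usetE (small1 _)).
apply/sat_FAnd; split.
  by apply/(sat_FPair _ (isT : 42 < 50)%N x50 y50); rewrite !updateE /= !neE.
by apply/(sat_FPair _ (isT : 40 < 50)%N (isT : 42 < 50)%N z50); rewrite !updateE /= !neE.
Qed.

End Formulas.

(** * Transfer for an arbitrary map preserving bounded formulas, such as an iterate of [star] *)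

Section Transfer.
Variables (V : universe) (S : V -> V).
Hypothesis transferS : forall (phi : bformula) (e : nat -> V),
  satisfies e phi <-> satisfies (S \o e) phi.
Implicit Types (x y z A B f N : V).

Let env (l : seq V) : nat -> V := nth point l.

Lemma transfer_elt x A : elt x A <-> elt (S x) (S A).
Proof. exact: (transferS (FElt 0 1) (env [:: x; A])). Qed.

Lemma transfer_opair x y : S (opair x y) = opair (S x) (S y).
Proof.
have := transferS (FPair 0 1 2) (env [:: opair x y; x; y]).
by rewrite !sat_FPair //= => -[-> //].
Qed.

Lemma transfer_sub A B : (forall x, elt x A -> elt x B) ->
  forall x, elt x (S A) -> elt x (S B).
Proof. exact: (transferS (FAll 2 0 (FElt 2 1)) (env [:: A; B])).1. Qed.

Lemma transfer_disjoint A B : (forall x, elt x A -> ~ elt x B) ->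
  forall x, elt x (S A) -> ~ elt x (S B).
Proof. exact: (transferS (FAll 2 0 (FNot (FElt 2 1))) (env [:: A; B])).1. Qed.

(** For the graph [f] of an operation, [B] is the section of those [n] in [N] whose value at
    [(n, x)] lies in [A]. Quantifying over the value instead of using [uapp] keeps the condition a
    bounded formula. *)
Lemma transfer_section_l N A B f x :
  (forall n, elt n N ->
    elt n B <-> exists2 y, elt y A & elt (opair (opair n x) y) f) ->
  forall n, elt n (S N) ->
    elt n (S B) <-> exists2 y, elt y (S A) & elt (opair (opair n (S x)) y) (S f).
Proof.
move=> H.
(* Variables 0 to 4 stand for [N], [B], [A], [x] and [f]; 5 is [n] and 6 its value. *)
pose ex := FEx 6 2 (FGraph 4 5 3 6).
pose phi := FAll 5 0 (FAnd (FImp (FElt 5 1) ex) (FImp ex (FElt 5 1))).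
have : satisfies (env [:: N; B; A; x; f]) phi.
  apply/sat_FAll => n /H[H1 H2]; apply/sat_FAnd; split; apply/sat_FImp.
    by move=> /H1[y yA yf]; apply/sat_FEx; exists y; [exact: yA|exact/sat_FGraph].
  by move=> /sat_FEx[y yA /sat_FGraph yf]; apply: H2; exists y; [exact: yA|exact: yf].
move=> /transferS/sat_FAll {}H n /H/sat_FAnd[/sat_FImp H1 /sat_FImp H2]; split.
  by move=> /H1/sat_FEx[y yA /sat_FGraph yf]; exists y; [exact: yA|exact: yf].
by move=> [y yA yf]; apply: H2; apply/sat_FEx; exists y; [exact: yA|exact/sat_FGraph].
Qed.

Lemma transfer_section_r N A B f x :
  (forall n, elt n N ->
    elt n B <-> exists2 y, elt y A & elt (opair (opair x n) y) f) ->
  forall n, elt n (S N) ->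
    elt n (S B) <-> exists2 y, elt y (S A) & elt (opair (opair (S x) n) y) (S f).
Proof.
move=> H.
pose ex := FEx 6 2 (FGraph 4 3 5 6).
pose phi := FAll 5 0 (FAnd (FImp (FElt 5 1) ex) (FImp ex (FElt 5 1))).
have : satisfies (env [:: N; B; A; x; f]) phi.
  apply/sat_FAll => n /H[H1 H2]; apply/sat_FAnd; split; apply/sat_FImp.
    by move=> /H1[y yA yf]; apply/sat_FEx; exists y; [exact: yA|exact/sat_FGraph].
  by move=> /sat_FEx[y yA /sat_FGraph yf]; apply: H2; exists y; [exact: yA|exact: yf].
move=> /transferS/sat_FAll {}H n /H/sat_FAnd[/sat_FImp H1 /sat_FImp H2]; split.
  by move=> /H1/sat_FEx[y yA /sat_FGraph yf]; exists y; [exact: yA|exact: yf].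
by move=> [y yA yf]; apply: H2; apply/sat_FEx; exists y; [exact: yA|exact/sat_FGraph].
Qed.

Definition operation_on N f := forall x y, elt x N -> elt y N ->
  exists2 z, elt z N & forall z', elt (opair (opair x y) z') f <-> z' = z.

Lemma transfer_operation N f : operation_on N f -> operation_on (S N) (S f).
Proof.
move=> H.
(* Uniqueness needs a bound for [z']: it is an element of an element of a member of the graph. *)
pose phi := FAll 2 0 (FAll 3 0 (FEx 4 0 (FAnd (FGraph 1 2 3 4)
  (FAll 5 1 (FAll 6 5 (FAll 7 6 (FImp (FGraph 1 2 3 7) (FEq 7 4)))))))).
have : satisfies (env [:: N; f]) phi.
  apply/sat_FAll => x xN; apply/sat_FAll => y yN; have [z zN zP] := H x y xN yN.
  apply/sat_FEx; exists z; first exact: zN.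
  apply/sat_FAnd; split; first by apply/sat_FGraph; rewrite ?zP.
  apply/sat_FAll => p _; apply/sat_FAll => s _; apply/sat_FAll => z' _; apply/sat_FImp.
  by move=> /sat_FGraph => /(_ isT isT isT isT)/zP.
move=> /transferS/sat_FAll {}H x y xN yN.
have /sat_FAll/(_ y yN)/sat_FEx[z zN /sat_FAnd[/sat_FGraph zP /sat_FAll zU]] := H x xN.
exists z; [exact: zN|move=> z'; split => [z'P|->]; last exact: zP].
have sz' : elt (uset [set opair x y; z']) (opair (opair x y) z').
  by apply/uset_pairE; right.
have zs' : elt z' (uset [set opair x y; z']) by apply/uset_pairE; right.
have /sat_FAll/(_ _ sz')/sat_FAll/(_ _ zs')/sat_FImp := zU _ z'P.
by apply; apply/sat_FGraph.
Qed.

Lemma uapp_operation N f x y : operation_on N f -> elt x N -> elt y N ->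
  elt (uapp f (opair x y)) N /\
  forall z, elt (opair (opair x y) z) f <-> z = uapp f (opair x y).
Proof.
move=> H xN yN; have [z zN zP] := H x y xN yN.
have -> : uapp f (opair x y) = z.
  by apply: get_unique => [|w]; [exact/zP|move=> /zP].
by split.
Qed.

Lemma transfer_uapp N f x y : operation_on N f -> elt x N -> elt y N ->
  S (uapp f (opair x y)) = uapp (S f) (opair (S x) (S y)).
Proof.
move=> H xN yN; have [zN zP] := uapp_operation H xN yN.
have [_ <-] := uapp_operation (transfer_operation H)
  ((transfer_elt _ _).1 xN) ((transfer_elt _ _).1 yN).
by rewrite -!transfer_opair -transfer_elt; exact/zP.
Qed.

End Transfer.

(** * Ultrafilters generated by hypernatural numbers *)

Section HyperTransfer.
Variables (V : universe) (star : nonstandard_embedding V).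
Implicit Types (x y z xi nu mu : V) (A B : set nat).

Lemma transfer_iter k (phi : bformula) (e : nat -> V) :
  satisfies e phi <-> satisfies (iter k star \o e) phi.
Proof.
elim: k => [//|k IH]; rewrite IH.
exact: (transfer star phi (iter k star \o e)).
Qed.

Lemma hyper_num k n : hyper star k (num V n) = num V n.
Proof. by elim: k => //= k IH; rewrite /hyper /= -/(hyper star k _) IH star_num. Qed.

Lemma elt_num_hnat k n : elt (num V n) (hnat star k).
Proof.
rewrite -(hyper_num k); apply: (transfer_elt (transfer_iter k) _ (unat_set V setT)).1.
exact/elt_unat_set.
Qed.

(** The inclusion of the natural numbers in their first extension is transferred [k] times. *)
Lemma hnat_succ k x : elt x (hnat star k) -> elt x (hnat star k.+1).
Proof.
rewrite /hnat /hyper iterSr; apply: (transfer_sub (transfer_iter k)).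
by move=> _ /unat_setE[n _ ->]; exact: (elt_num_hnat 1).
Qed.

Lemma hnat_operation op k : operation_on (hnat star k) (hyper star k (unat_op V op)).
Proof.
apply: (transfer_operation (transfer_iter k)).
move=> _ _ /unat_setE[m _ ->] /unat_setE[n _ ->].
exists (num V (op m n)); first exact/elt_unat_set.
by move=> z; exact: unat_op_graph.
Qed.

Lemma uapp_exists op k x y C : elt x (hnat star k) -> elt y (hnat star k) ->
  (exists2 z, elt z C & elt (opair (opair x y) z) (hyper star k (unat_op V op))) <->
  elt (uapp (hyper star k (unat_op V op)) (opair x y)) C.
Proof.
move=> xN yN; have [_ xyP] := uapp_operation (@hnat_operation op k) xN yN.
split => [[z zC /xyP <-]//|xyC].
by exists (uapp (hyper star k (unat_op V op)) (opair x y)) => //; apply/xyP.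
Qed.

Lemma hadd_hnat k x y : elt x (hnat star k) -> elt y (hnat star k) ->
  elt (hadd star k x y) (hnat star k).
Proof. by move=> xN yN; have [] := uapp_operation (@hnat_operation addn k) xN yN. Qed.

Lemma hmul_hnat k x y : elt x (hnat star k) -> elt y (hnat star k) ->
  elt (hmul star k x y) (hnat star k).
Proof. by move=> xN yN; have [] := uapp_operation (@hnat_operation muln k) xN yN. Qed.

Lemma hyper_hnat k j x : elt x (hnat star j) -> elt (hyper star k x) (hnat star (k + j)).
Proof.
rewrite /hnat /hyper iterD; exact: (transfer_elt (transfer_iter k) _ _).1.
Qed.

Lemma ultra_ofE k nu A :
  ultra_of star k nu A = elt nu (hyper star k (unat_set V A)).
Proof. by []. Qed.

Lemma ultra_of_op_num op c xi A : elt xi (hnat star 1) ->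
  ultra_of star 1 (uapp (hyper star 1 (unat_op V op)) (opair (num V c) xi)) A <->
  ultra_of star 1 xi [set n | A (op c n)].
Proof.
move=> xiN; rewrite !ultra_ofE -uapp_exists //; last exact: (elt_num_hnat 1).
(* The numeral is its own image under [star], so it can serve as the transferred parameter of a
   section. *)
rewrite /hyper /= -{1}(star_num star c).
apply: iff_sym; apply: (transfer_section_r (transfer star) _ xiN).
move=> _ /unat_setE[n _ ->]; rewrite elt_unat_set; split => [Acn|[y yA yE]].
  by exists (num V (op c n)); [exact/elt_unat_set|exact/unat_op_graph].
by move: yA; move: yE => /unat_op_graph -> /elt_unat_set.
Qed.

Lemma ultra_of_hmul c xi : elt xi (hnat star 1) ->
  ultra_of star 1 (hmul star 1 (num V c) xi) = scale c (ultra_of star 1 xi).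
Proof.
move=> xiN; apply/funext => A; apply/propext; rewrite ultra_of_op_num //.
suff -> : [set n | A (c * n)%N] = [set n | A (n * c)%N] by [].
by apply/funext => n; rewrite /mkset mulnC.
Qed.

(** For a numeral [n], [n + mu] lies in [*A] iff [A - n] belongs to the ultrafilter of [mu].
    Transferring this [k] times, with parameter [mu], and evaluating at [nu] gives the
    pseudo-sum. *)
Lemma ultra_of_hadd k nu mu : elt nu (hnat star k) -> elt mu (hnat star 1) ->
  ultra_of star k.+1 (hadd star k.+1 nu (hyper star k mu)) =
  pseudo_sum (ultra_of star k nu) (ultra_of star 1 mu).
Proof.
move=> nuN muN; apply/funext => A; apply/propext.
have kmuN : elt (hyper star k mu) (hnat star k.+1).
  by rewrite -addn1; exact: hyper_hnat.
rewrite pseudo_sumE !ultra_ofE -uapp_exists //; last exact: hnat_succ.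
(* The extensions of level [k.+1] become level [k] extensions of [*A] and of the first extension of
   addition, ready for [transfer_iter k]. *)
rewrite /hyper !iterSr; apply: iff_sym.
apply: (transfer_section_l (transfer_iter k) _ nuN) => _ /unat_setE[n _ ->].
rewrite elt_unat_set.
apply: (iff_trans _ (iff_sym (@uapp_exists addn 1 _ _ _ (elt_num_hnat 1 n) muN))).
apply: (iff_trans _ (iff_sym (ultra_of_op_num addn n A muN))).
suff -> : [set m | A (n + m)%N] = [set m | A (m + n)%N] by [].
by apply/funext => m; rewrite /mkset addnC.
Qed.

Lemma hyper_hmul k c xi : elt xi (hnat star 1) ->
  hmul star k.+1 (num V c) (hyper star k xi) = hyper star k (hmul star 1 (num V c) xi).
Proof.
move=> xiN; rewrite /hmul /hyper iterSr.
rewrite (transfer_uapp (transfer_iter k) (@hnat_operation muln 1) _ xiN).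
  by rewrite -[in LHS](hyper_num k c).
exact: (elt_num_hnat 1).
Qed.

Lemma hyper_lin_hnat xi a k : elt xi (hnat star 1) ->
  elt (hyper_lin star xi a k) (hnat star k.+1).
Proof.
move=> xiN; elim: k => [|k IH] /=; first by apply: hmul_hnat => //; exact: elt_num_hnat.
apply: hadd_hnat; first exact: hnat_succ.
apply: hmul_hnat; first exact: elt_num_hnat.
rewrite -[k.+2]addn1; exact: (@hyper_hnat k.+1 1).
Qed.

Lemma ultra_of_hyper_lin xi a k : elt xi (hnat star 1) ->
  ultra_of star k.+1 (hyper_lin star xi a k) = pseudo_lin (ultra_of star 1 xi) a k.
Proof.
move=> xiN; elim: k => [|k IH] /=; first exact: ultra_of_hmul.
rewrite hyper_hmul // ultra_of_hadd ?IH ?ultra_of_hmul //; first exact: hyper_lin_hnat.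
by apply: hmul_hnat => //; exact: elt_num_hnat.
Qed.

Lemma ultra_of_realize (U : set_system nat) : UltraFilter U ->
  exists2 xi, elt xi (hnat star 1) & ultra_of star 1 xi = U.
Proof.
move=> uU; have pU : ProperFilter U by exact: ultra_proper.
have [||xi xiU] := enlargement star (F := [set unat_set V A | A in U]).
(* The family is an image of [U], a collection of subsets of the natural numbers. *)
- apply: card_le_trans (card_image_le _ _) _; exact: card_leT.
- move=> D DU.
  have UD C : C \in D -> U [set n | elt (num V n) C].
    by move=> /DU/set_mem[A UA <-]; apply: filterS UA => n An; apply/elt_unat_set.
  have [n nD] := filter_ex (filter_bigI _ UD).
  by exists (num V n) => C /nD.
have sub A : U A -> ultra_of star 1 xi A by move=> UA; apply: xiU; exists A.
exists xi; first by apply: (sub setT); exact: filterT.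
apply/funext => A; apply/propext; split => [xiA|/sub//].
(* If [A] is not in [U], its complement is, and transfer keeps their extensions disjoint. *)
have [//|/sub xinA] := in_ultra_setVsetC A uU.
exfalso; apply: (transfer_disjoint (transfer star) _ xiA xinA).
by move=> _ /unat_setE[n An ->] /elt_unat_set.
Qed.
End HyperTransfer.

Theorem theorem3p6 (V : universe) (star : nonstandard_embedding V)
    (k h : nat) (a b : nat -> nat) :
  (u_equiv [seq Posz (a i) | i <- iota 0 k.+1]
           [seq Posz (b i) | i <- iota 0 h.+1]
   <->
   (forall U : set_system nat, idempotent_ultrafilter U ->
      pseudo_lin U a k = pseudo_lin U b h))
  /\
  ((forall U : set_system nat, idempotent_ultrafilter U ->
      pseudo_lin U a k = pseudo_lin U b h)
   <->
   (forall xi : V, elt xi (hnat star 1) ->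
      idempotent_ultrafilter (ultra_of star 1 xi) ->
      u_sim star k.+1 (hyper_lin star xi a k) h.+1 (hyper_lin star xi b h))).
Proof.
split; split.
- move=> ab U iU; rewrite -!string_sum_iota; exact: string_sum_u_equiv.
- move=> ab; rewrite [in X in u_equiv X _](map_comp Posz a).
  rewrite [in X in u_equiv _ X](map_comp Posz b).
  apply: u_equiv_string_sum => U iU; rewrite -!map_comp !string_sum_iota; exact: ab.
- by move=> ab xi xiN iU; rewrite /u_sim !ultra_of_hyper_lin //; exact: ab.
- move=> ab U iU; have [uU _ _] := iU.
  have [xi xiN xiU] := ultra_of_realize star uU.
  by have := ab xi xiN; rewrite /u_sim !ultra_of_hyper_lin // xiU; exact.
Qed.
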